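(* Let $\eta,\mu>0$, $(x,y)\in\mathbb R^n\times\mathbb R^m$, and let $q$, $Q$, $q_{\eta,\mu}$, $Q_{\eta,\mu}$ be as in the context. (a) If $q\in\mathcal C^1(\mathbb R^{n+m};L_{1,q})$, then $$\mathbb E\|\nabla_xQ_{\eta,\mu}(x,y,\zeta)-\nabla_xq_{\eta,\mu}(x,y)\|^2\le\frac{(L_{1,q}+L_{1,Q})^2}{2}\Big(\eta(n+3)^{3/2}+\frac{\mu^2}\eta mn^{1/2}\Big)^2+2\sigma_{1,Q}^2,$$ $$\mathbb E\|\nabla_yQ_{\eta,\mu}(x,y,\zeta)-\nabla_yq_{\eta,\mu}(x,y)\|^2\le\frac{(L_{1,q}+L_{1,Q})^2}{2}\Big(\frac{\eta^2}\mu nm^{1/2}+\mu(m+3)^{3/2}\Big)^2+2\sigma_{1,Q}^2.$$ (b) If $q\in\mathcal C^2(\mathbb R^{n+m};L_{2,q})$, then $$\mathbb E\|\nabla^2_{xy}Q_{\eta,\mu}(x,y,\zeta)-\nabla^2_{xy}q_{\eta,\mu}(x,y)\|^2\le\frac{8(L_{2,q}+L_{2,Q})^2}{9}\Big(\frac{\eta^2}\mu(n+4)^2m^{1/2}+\frac{\mu^2}\eta(m+4)^2n^{1/2}\Big)^2+2\sigma_{2,Q}^2.$$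
   Context: $m,n\ge1$. $\zeta$ is a random vector independent of the independent Gaussian vectors $u\sim\mathcal N(0,I_n)$, $v\sim\mathcal N(0,I_m)$; $Q(x,y,\zeta)$ is a stochastic function with $q(x,y)=\mathbb E_\zeta[Q(x,y,\zeta)]$. Set $Q_{\eta,\mu}(x,y,\zeta)=\mathbb E_{u,v}[Q(x+\eta u,y+\mu v,\zeta)]$ and $q_{\eta,\mu}(x,y)=\mathbb E_{u,v,\zeta}[Q(x+\eta u,y+\mu v,\zeta)]$. The derivatives of $Q_{\eta,\mu}$ are with respect to $(x,y)$ at fixed $\zeta$; equivalently $\nabla_xQ_{\eta,\mu}(x,y,\zeta)=\mathbb E_{u,v}\big[\frac{Q(x+\eta u,y+\mu v,\zeta)-Q(x,y,\zeta)}{\eta}u\big]$, similarly $\nabla_yQ_{\eta,\mu}$ with $\mu,v$ in place of $\eta,u$ outside, and $\nabla^2_{xy}Q_{\eta,\mu}(x,y,\zeta)=\mathbb E_{u,v}\big[uv^\top\frac{Q(x+\eta u,y+\mu v,\zeta)+Q(x-\eta u,y-\mu v,\zeta)-2Q(x,y,\zeta)}{2\eta\mu}\big]$. $\mathcal C^i(S;L_{i,q})$ is the class of $i$ times differentiable functions whose $i$-th derivative is Lipschitz on $S$ with constant $L_{i,q}$. Standing assumptions on $Q$: in part (a), $Q(\cdot,\cdot,\zeta)\in\mathcal C^1(\mathbb R^{n+m};L_{1,Q})$ for every $\zeta$, its gradient is an unbiased estimator of $\nabla q$, and $\mathbb E\|\nabla Q-\nabla q\|^2\le\sigma_{1,Q}^2$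 at every point; in part (b), $Q(\cdot,\cdot,\zeta)\in\mathcal C^2(\mathbb R^{n+m};L_{2,Q})$ for every $\zeta$, its Hessian is an unbiased estimator of $\nabla^2q$, and $\mathbb E\|\nabla^2Q-\nabla^2q\|_F^2\le\sigma_{2,Q}^2$ at every point. Norms are Euclidean for vectors, operator norms for matrices; $\|\cdot\|_F$ is the Frobenius norm. *)

(* Defs.v *)
From mathcomp Require Import all_boot all_order all_algebra.
From mathcomp Require Import all_classical all_reals all_analysis.

Set Implicit Arguments.
Unset Strict Implicit.
Unset Printing Implicit Defensive.

Import Order.TTheory GRing.Theory Num.Theory.
Import numFieldNormedType.Exports.

Local Open Scope classical_set_scope.
Local Open Scope ring_scope.

(* The norm `|_| that MathComp-Analysis puts on matrices is the sup norm, hence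
   the explicit norms below. On row or column vectors, frobnorm is the
   Euclidean norm. *)
Definition frobnorm (R : realType) (m n : nat) (A : 'M[R]_(m, n)) : R :=
  Num.sqrt (\sum_(i < m) \sum_(j < n) A i j ^+ 2).

Definition opnorm (R : realType) (m n : nat) (A : 'M[R]_(m, n)) : R :=
  sup [set frobnorm (A *m v) | v in [set v : 'cV[R]_n | frobnorm v <= 1]].

Definition grad (R : realType) (N : nat) (f : 'rV[R]_N -> R) (p : 'rV[R]_N) :
  'rV[R]_N := \row_i 'D_(delta_mx 0 i) f p.

Definition hess (R : realType) (N : nat) (f : 'rV[R]_N -> R) (p : 'rV[R]_N) :
  'M[R]_N := \matrix_(i, j) 'D_(delta_mx 0 j) ('D_(delta_mx 0 i) f) p.

Definition classC1 (R : realType) (N : nat) (L : R) (f : 'rV[R]_N -> R) : Prop :=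
  (forall p, differentiable f p) /\
  (forall p p', frobnorm (grad f p - grad f p') <= L * frobnorm (p - p')).

Definition classC2 (R : realType) (N : nat) (L : R) (f : 'rV[R]_N -> R) : Prop :=
  [/\ forall p, differentiable f p,
      forall p, differentiable (grad f) p &
      forall p p', opnorm (hess f p - hess f p') <= L * frobnorm (p - p')].

(* R^n x R^m is identified with R^(n+m), (x, y) being row_mx x y. *)
Definition joint (R : realType) (n m : nat) (f : 'rV[R]_n -> 'rV[R]_m -> R) :
  'rV[R]_(n + m) -> R := fun p => f (lsubmx p) (rsubmx p).

Definition grad_x (R : realType) (n m : nat) (f : 'rV[R]_n -> 'rV[R]_m -> R)
  (x : 'rV[R]_n) (y : 'rV[R]_m) : 'rV[R]_n :=
  lsubmx (grad (joint f) (row_mx x y)).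

Definition grad_y (R : realType) (n m : nat) (f : 'rV[R]_n -> 'rV[R]_m -> R)
  (x : 'rV[R]_n) (y : 'rV[R]_m) : 'rV[R]_m :=
  rsubmx (grad (joint f) (row_mx x y)).

(* the n x m block of entries d/dy_j (d/dx_i f) *)
Definition hess_xy (R : realType) (n m : nat) (f : 'rV[R]_n -> 'rV[R]_m -> R)
  (x : 'rV[R]_n) (y : 'rV[R]_m) : 'M[R]_(n, m) :=
  ursubmx (hess (joint f) (row_mx x y)).

(* Random vectors take values in n.-tuple R, which carries the product
   sigma-algebra; matrices have no measurable structure in the library. *)
Definition vec (R : realType) (n : nat) (t : n.-tuple (measurableTypeR R)) :
  'rV[R]_n := \row_i tnth t i.

(* u ~ N(0, I_n): the law of u is the n-fold product of N(0, 1), which is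
   determined by its values on measurable rectangles. *)
Definition std_gaussian (d : measure_display) (Omega : measurableType d)
    (R : realType) (P : probability Omega R) (n : nat)
    (u : {RV P >-> n.-tuple (measurableTypeR R)}) : Prop :=
  forall A : 'I_n -> set (measurableTypeR R), (forall i, measurable (A i)) ->
  distribution P u [set t | forall i, A i (tnth t i)] =
  (\prod_(i < n) normal_prob 0 1 (A i))%E.

(* mutual independence; the factorization over the subfamilies with two members
   is the case where the remaining set is setT *)
Definition independent3 (d d1 d2 d3 : measure_display) (Omega : measurableType d)
    (T1 : measurableType d1) (T2 : measurableType d2) (T3 : measurableType d3)
    (R : realType) (P : probability Omega R) (X1 : {RV P >-> T1})
    (X2 : {RV P >-> T2}) (X3 : {RV P >-> T3}) : Prop :=
  forall (A1 : set T1) (A2 : set T2) (A3 : set T3),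
  measurable A1 -> measurable A2 -> measurable A3 ->
  P (X1 @^-1` A1 `&` X2 @^-1` A2 `&` X3 @^-1` A3) =
  (P (X1 @^-1` A1) * P (X2 @^-1` A2) * P (X3 @^-1` A3))%E.

Section Smoothing.
Context (d : measure_display) (Omega : measurableType d) (R : realType).
Context (P : probability Omega R) (n m k : nat).
Context (u : {RV P >-> n.-tuple (measurableTypeR R)}).
Context (v : {RV P >-> m.-tuple (measurableTypeR R)}).
Context (zeta : {RV P >-> k.-tuple (measurableTypeR R)}).
Context (Q : 'rV[R]_n -> 'rV[R]_m -> k.-tuple (measurableTypeR R) -> R).
Context (q : 'rV[R]_n -> 'rV[R]_m -> R).

(* Q_{eta,mu}(., ., z): expectation over (u, v) only, at a fixed value z *)
Definition smoothQ (eta mu : R) (z : k.-tuple (measurableTypeR R))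
    (x : 'rV[R]_n) (y : 'rV[R]_m) : R :=
  fine 'E_P[fun w => (Q (x + eta *: vec (u w)) (y + mu *: vec (v w)) z)%R]%E.

Definition smoothq (eta mu : R) (x : 'rV[R]_n) (y : 'rV[R]_m) : R :=
  fine 'E_P[fun w =>
    (Q (x + eta *: vec (u w)) (y + mu *: vec (v w)) (zeta w))%R]%E.

(* In the three definitions below the expectation lives in \bar R, and its
   equality with a finite number includes integrability: an integral whose
   positive or negative part is infinite is infinite. *)
Definition mean_of : Prop :=
  (forall x y, measurable_fun setT (Q x y)) /\
  (forall x y, ('E_P[fun w => (Q x y (zeta w))%R] = (q x y)%:E)%E).

Definition unbiased_grad : Prop := forall p i,
  ('E_P[fun w => (grad (joint (fun x y => Q x y (zeta w))) p 0 i)%R] =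
  (grad (joint q) p 0 i)%:E)%E.

Definition unbiased_hess : Prop := forall p i j,
  ('E_P[fun w => (hess (joint (fun x y => Q x y (zeta w))) p i j)%R] =
  (hess (joint q) p i j)%:E)%E.

Definition assumptionsC1 (L sigma : R) : Prop :=
  [/\ forall z, classC1 L (joint (fun x y => Q x y z)),
      unbiased_grad &
      forall p, ('E_P[fun w => ((frobnorm (
        grad (joint (fun x y => Q x y (zeta w))) p - grad (joint q) p)) ^+ 2)%R]
        <= (sigma ^+ 2)%:E)%E].

Definition assumptionsC2 (L sigma : R) : Prop :=
  [/\ forall z, classC2 L (joint (fun x y => Q x y z)),
      unbiased_hess &
      forall p, ('E_P[fun w => ((frobnorm (
        hess (joint (fun x y => Q x y (zeta w))) p - hess (joint q) p)) ^+ 2)%R]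
        <= (sigma ^+ 2)%:E)%E].

End Smoothing.

(* Main.v *)
Require Import Defs.
From mathcomp Require Import all_boot all_order all_algebra.
From mathcomp Require Import all_classical all_reals all_analysis.
From mathcomp Require Import measurable_realfun.
From mathcomp Require Import ring lra.

Set Implicit Arguments.
Unset Strict Implicit.
Unset Printing Implicit Defensive.

Import Order.TTheory GRing.Theory Num.Theory.
Import numFieldNormedType.Exports.

Local Open Scope classical_set_scope.
Local Open Scope ring_scope.

(** Write S = (eta u, mu v) for the random perturbation and p = (x, y). Smoothing
    is averaging over shifts, F |-> E[F(p + S)], and it commutes with partial
    derivatives: under the smoothness assumptions F, its gradient and, in the
    second-order case, its Hessian grow at most polynomially, all moments of S
    are finite because it is Gaussian, so dominated convergence applies
    ([derive_smooth]). Independence of S and zeta together with Fubini's theorem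
    shows that q_{eta,mu} is the smoothing of q itself ([joint_smoothq]). Hence,
    at a fixed value z of zeta,

      grad Q_{eta,mu}(p, z) - grad q_{eta,mu}(p)
        = E_S[ grad Q(p + S, z) - grad q(p + S) ],

    and likewise for the Hessians. By Jensen's inequality the squared norm of
    this average is at most the average of the squared norms; exchanging the
    expectations over zeta and S by Tonelli's theorem, and using the variance
    hypothesis at each shifted point p + S, its mean over zeta is at most
    sigma^2 ([mean_square_smooth_le], [mean_square_grad_le],
    [mean_square_hess_le]). The x-gradient, the y-gradient and the xy-block of
    the Hessian are blocks of the full derivative, so their norms are no larger,
    and the operator norm is below the Frobenius norm. The stated bounds follow:
    each of them is a nonnegative quantity plus 2 sigma^2.

    The finiteness needed by Fubini's theorem is a matter of growth uniform
    enough in zeta: Q(., ., z) is dominated by C(z) (1 + |p|)^r, where C(z) is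
    built from the values at the origin of Q and of its first (and second)
    partial derivatives, all of which are integrable in zeta. In the
    second-order case the first partial derivatives at the origin are controlled
    by values of Q and of the Hessian through the mean value theorem
    ([classC2_partial_le]). *)

(** * Frobenius, operator and sup norms *)

Section Norms.
Context (R : realType).
Implicit Types m n N : nat.

Lemma frobnorm_ge0 m n (A : 'M[R]_(m, n)) : 0 <= frobnorm A.
Proof. exact: sqrtr_ge0. Qed.

Lemma sqr_frobnorm m n (A : 'M[R]_(m, n)) :
  frobnorm A ^+ 2 = \sum_(i < m) \sum_(j < n) A i j ^+ 2.
Proof.
rewrite sqr_sqrtr// !sumr_ge0// => i _.
by rewrite sumr_ge0// => j _; rewrite sqr_ge0.
Qed.

Lemma sqr_entry_le m n (A : 'M[R]_(m, n)) i j : A i j ^+ 2 <= frobnorm A ^+ 2.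
Proof.
rewrite sqr_frobnorm (bigD1 i)//= (bigD1 j)//= -addrA lerDl.
rewrite addr_ge0// !sumr_ge0// => ? _; rewrite ?sqr_ge0// sumr_ge0// => ? _.
by rewrite sqr_ge0.
Qed.

Lemma entry_le_frobnorm m n (A : 'M[R]_(m, n)) i j : `|A i j| <= frobnorm A.
Proof.
rewrite -ler_sqr ?nnegrE ?frobnorm_ge0// real_normK ?num_real//.
exact: sqr_entry_le.
Qed.

(** Lagrange's identity: the defect is half the sum of the squares
    (a_i b_j - a_j b_i)^2. *)
Lemma cauchy_schwarz_sum (I : finType) (a b : I -> R) :
  (\sum_i a i * b i) ^+ 2 <= (\sum_i a i ^+ 2) * (\sum_i b i ^+ 2).
Proof.
have E i j : (a i * b j - a j * b i) ^+ 2 = a i ^+ 2 * b j ^+ 2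
    + b i ^+ 2 * a j ^+ 2 - 2 * (a i * b i) * (a j * b j) by ring.
have : 0 <= \sum_i \sum_j (a i * b j - a j * b i) ^+ 2.
  by apply: sumr_ge0 => i _; apply: sumr_ge0 => j _; exact: sqr_ge0.
rewrite (eq_bigr (fun i => a i ^+ 2 * (\sum_j b j ^+ 2)
    + b i ^+ 2 * (\sum_j a j ^+ 2)
    - 2 * (a i * b i) * \sum_j (a j * b j))); last first.
  move=> i _; rewrite !mulr_sumr -sumrN -!big_split/=.
  by apply: eq_bigr => j _; exact: E.
rewrite !big_split/= sumrN -!mulr_suml -mulr_sumr.
by move=> ?; lra.
Qed.

Lemma frobnorm_mulmx_le m n (A : 'M[R]_(m, n)) (x : 'cV[R]_n) :
  frobnorm (A *m x) <= frobnorm A * frobnorm x.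
Proof.
rewrite -ler_sqr ?nnegrE ?mulr_ge0 ?frobnorm_ge0// exprMn !sqr_frobnorm.
rewrite mulr_suml; apply: ler_sum => i _; rewrite big_ord1 mxE.
rewrite (le_trans (cauchy_schwarz_sum _ _))//.
by under [X in _ <= _ * X]eq_bigr do rewrite big_ord1.
Qed.

(** A bound for the set whose supremum is the operator norm: without one, [sup]
    would be a default value. *)
Lemma frobnorm_ubound_opnorm m n (A : 'M[R]_(m, n)) :
  ubound [set frobnorm (A *m v) | v in [set v : 'cV[R]_n | frobnorm v <= 1]]
    (frobnorm A).
Proof.
move=> _ [x /= x1 <-]; rewrite (le_trans (frobnorm_mulmx_le _ _))//.
by rewrite ler_piMr ?frobnorm_ge0.
Qed.

Lemma frobnorm0 m n : frobnorm (0 : 'M[R]_(m, n)) = 0.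
Proof.
rewrite /frobnorm big1 ?sqrtr0// => i _; rewrite big1// => j _.
by rewrite mxE expr0n.
Qed.

Lemma opnorm_le_frobnorm m n (A : 'M[R]_(m, n)) : opnorm A <= frobnorm A.
Proof.
apply: ge_sup; last exact: frobnorm_ubound_opnorm.
by exists (frobnorm (A *m (0 : 'cV[R]_n))); exists 0 => //=; rewrite frobnorm0.
Qed.

Lemma opnorm_ge0 m n (A : 'M[R]_(m, n)) : 0 <= opnorm A.
Proof.
apply: ub_le_sup; first by exists (frobnorm A); exact: frobnorm_ubound_opnorm.
by exists 0; rewrite /= ?mulmx0 frobnorm0.
Qed.

(** The (i, j) entry is a coordinate of the image of the j-th basis vector, which
    lies in the unit ball. *)
Lemma entry_le_opnorm m n (A : 'M[R]_(m, n)) i j : `|A i j| <= opnorm A.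
Proof.
have -> : A i j = (A *m delta_mx j 0 : 'cV_m) i 0.
  by rewrite -colE mxE.
rewrite (le_trans (entry_le_frobnorm _ _ _))//.
apply: ub_le_sup; first by exists (frobnorm A); exact: frobnorm_ubound_opnorm.
exists (delta_mx j 0) => //=; rewrite /frobnorm (bigD1 j)//= [X in _ + X]big1.
  by rewrite addr0 big_ord1 mxE !eqxx expr1n sqrtr1.
by move=> k kj; rewrite big_ord1 mxE (negbTE kj) expr0n.
Qed.

(** On row vectors [`|_|] is the sup norm, the norm used by the topology. *)
Lemma entry_le_norm N (p : 'rV[R]_N) j : `|p 0 j| <= `|p|.
Proof.
by rewrite [leRHS]mx_normrE; apply/bigmax_geP; right; exists (0, j).
Qed.

Lemma norm_row_le N (p : 'rV[R]_N) (c : R) :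
  0 <= c -> (forall j, `|p 0 j| <= c) -> `|p| <= c.
Proof.
move=> c0 pc; rewrite [leLHS]mx_normrE; apply/bigmax_leP; split => // -[i j] _.
by rewrite ord1.
Qed.

Lemma frobnorm_row_le N (p : 'rV[R]_N) : frobnorm p <= N%:R * `|p|.
Proof.
rewrite -ler_sqr ?nnegrE ?frobnorm_ge0 ?mulr_ge0// sqr_frobnorm big_ord1.
apply: (@le_trans _ _ (\sum_(j < N) `|p| ^+ 2)).
  apply: ler_sum => j _; rewrite -real_normK ?num_real// lerXn2r ?nnegrE//.
  exact: entry_le_norm.
rewrite sumr_const card_ord exprMn -[leLHS]mulr_natl ler_wpM2r ?sqr_ge0//.
by case: N {p} => [|N]; rewrite ?expr0n// expr2 ler_peMl// ler1n.
Qed.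

End Norms.

Lemma sqr_frobnorm_lsubmx_le (R : realType) a n m (A : 'M[R]_(a, n + m)) :
  frobnorm (lsubmx A) ^+ 2 <= frobnorm A ^+ 2.
Proof.
rewrite !sqr_frobnorm; apply: ler_sum => i _; rewrite big_split_ord/=.
under eq_bigr do rewrite mxE.
by rewrite lerDl sumr_ge0// => j _; rewrite sqr_ge0.
Qed.

Lemma sqr_frobnorm_rsubmx_le (R : realType) a n m (A : 'M[R]_(a, n + m)) :
  frobnorm (rsubmx A) ^+ 2 <= frobnorm A ^+ 2.
Proof.
rewrite !sqr_frobnorm; apply: ler_sum => i _; rewrite big_split_ord/=.
under eq_bigr do rewrite mxE.
by rewrite lerDr sumr_ge0// => j _; rewrite sqr_ge0.
Qed.

Lemma sqr_frobnorm_usubmx_le (R : realType) a n m (A : 'M[R]_(n + m, a)) :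
  frobnorm (usubmx A) ^+ 2 <= frobnorm A ^+ 2.
Proof.
rewrite !sqr_frobnorm big_split_ord/=.
under eq_bigr do under eq_bigr do rewrite mxE.
by rewrite lerDl sumr_ge0// => j _; rewrite sumr_ge0// => i _; rewrite sqr_ge0.
Qed.

(** * Mean value theorem and polynomial growth *)

Section Growth.
Context (R : realType) (N : nat).
Implicit Types (f : 'rV[R]_N -> R) (p v : 'rV[R]_N) (C L : R) (k : nat).

Lemma derive_sum_partials f p v : differentiable f p ->
  'D_v f p = \sum_i v 0 i * 'D_(delta_mx 0 i) f p.
Proof.
move=> df; rewrite deriveE// {1}(row_sum_delta v) linear_sum.
by apply: eq_bigr => i _; rewrite linearZ/= deriveE.
Qed.

Lemma line_quotientE f p v (t : R) :
  (fun h : R => h^-1 *: (((fun s : R => f (p + s *: v)) \o shift t) (h *: 1)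
                           - f (p + t *: v)))
  = (fun h : R => h^-1 *: ((f \o shift (p + t *: v)) (h *: v)
                           - f (p + t *: v))).
Proof.
apply/funext => h /=; congr (_ *: (f _ - _)).
by rewrite [h%:A]mulr1 scalerDl addrCA.
Qed.

(** Both sides are the limit of the same quotients, whether or not it exists;
    this reduces directional derivatives to one-variable calculus. *)
Lemma derive_line f p v (t : R) :
  'D_1 (fun s : R => f (p + s *: v)) t = 'D_v f (p + t *: v).
Proof. by rewrite /derive line_quotientE. Qed.

Lemma is_derive_line f p v (t : R) : differentiable f (p + t *: v) ->
  is_derive t 1 (fun s : R => f (p + s *: v)) ('D_v f (p + t *: v)).
Proof.
move=> df; apply: DeriveDef; last exact: derive_line.
by rewrite /derivable line_quotientE; exact: diff_derivable.
Qed.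

Lemma mvt_line f p v (t : R) : 0 <= t -> (forall q, differentiable f q) ->
  exists2 c, 0 <= c <= t & f (p + t *: v) - f p = t * 'D_v f (p + c *: v).
Proof.
move=> t0 df.
have dl (s : R) := is_derive_line (df (p + s *: v)).
have [|c] := MVT_segment t0 (fun x _ => dl x).
  by apply: derivable_within_continuous => s _; case: (dl s).
rewrite in_itv/= => ct; rewrite scale0r addr0 subr0 => ->.
by exists c => //; rewrite mulrC.
Qed.

Definition has_growth f C k := forall p, `|f p| <= C * (1 + `|p|) ^+ k.

Lemma has_growth_ge0 f C k : has_growth f C k -> 0 <= C.
Proof.
move=> /(_ 0); rewrite normr0 addr0 expr1n mulr1.
exact: le_trans.
Qed.

Lemma has_growth_le f C C' k : C <= C' -> has_growth f C k -> has_growth f C' k.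
Proof.
by move=> CC fC p; rewrite (le_trans (fC p))// ler_wpM2r// exprn_ge0// addr_ge0.
Qed.

(** The mean value theorem on the segment from 0 to p: each integration of the
    partial derivatives raises the degree of growth by one. *)
Lemma has_growth_of_partials f C k : 0 <= C -> (forall p, differentiable f p) ->
  (forall i, has_growth ('D_(delta_mx 0 i) f) C k) ->
  has_growth f (`|f 0| + N%:R * C) k.+1.
Proof.
move=> C0 df fC p.
have [c /andP[c0 c1]] := mvt_line 0 p ler01 df.
rewrite scale1r add0r mul1r add0r => fE.
have X1 : 1 <= (1 + `|p|) ^+ k by rewrite exprn_ege1// lerDl.
have X0 : 0 <= (1 + `|p|) ^+ k by exact: le_trans X1.
have p0 : 0 <= `|p| by [].
have D : `|'D_p f (c *: p)| <= N%:R * C * `|p| * (1 + `|p|) ^+ k.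
  rewrite derive_sum_partials//.
  rewrite (le_trans (ler_norm_sum _ _ _))//.
  apply: (@le_trans _ _ (\sum_(i < N) `|p| * (C * (1 + `|p|) ^+ k))).
    apply: ler_sum => i _; rewrite normrM ler_pM ?entry_le_norm//.
    rewrite (le_trans (fC _ _))// ler_wpM2l// lerXn2r ?nnegrE ?addr_ge0//.
    by rewrite lerD2l normrZ ger0_norm// ler_piMl.
  rewrite sumr_const card_ord -[leLHS]mulr_natl le_eqVlt; apply/orP; left.
  by apply/eqP; ring.
have -> : f p = f 0 + 'D_p f (c *: p) by rewrite -fE addrC subrK.
rewrite (le_trans (ler_normD _ _))// exprS mulrDl lerD//.
  by rewrite ler_peMr// mulr_ege1// lerDl.
rewrite (le_trans D)// mulrA ler_wpM2r// ler_wpM2l ?mulr_ge0//.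
by rewrite lerDr.
Qed.

Lemma lipschitz_continuous f L :
  (forall p p', `|f p - f p'| <= L * `|p - p'|) -> continuous f.
Proof.
move=> fL p; apply/(@cvgrPdist_lt _ _ _ (nbhs p)) => e e0.
have K0 : 0 < `|L| + 1 by rewrite ltr_wpDl.
apply/(nbhs_ballP (M := 'rV[R]_N) p).
exists (e / (`|L| + 1)); first by rewrite /= divr_gt0.
move=> q; rewrite -ball_normE /= => pq; rewrite (le_lt_trans (fL _ _))//.
apply: (@le_lt_trans _ _ ((`|L| + 1) * `|p - q|)).
  by rewrite ler_wpM2r// (le_trans (ler_norm _))// lerDl.
by rewrite mulrC -ltr_pdivlMr.
Qed.

Lemma lipschitz_has_growth f L : 0 <= L ->
  (forall p p', `|f p - f p'| <= L * `|p - p'|) -> has_growth f (`|f 0| + L) 1.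
Proof.
move=> L0 fL p; have := fL p 0; rewrite subr0 expr1 => fp.
have -> : f p = f 0 + (f p - f 0) by rewrite addrC subrK.
rewrite (le_trans (ler_normD _ _))// mulrDl lerD//.
  by rewrite ler_peMr// lerDl.
by rewrite (le_trans fp)// ler_wpM2l// lerDr.
Qed.

Lemma classC1_lipschitz L f i : classC1 L f -> forall p p',
  `|'D_(delta_mx 0 i) f p - 'D_(delta_mx 0 i) f p'| <= `|L| * N%:R * `|p - p'|.
Proof.
move=> [_ fL] p p'.
have -> : 'D_(delta_mx 0 i) f p - 'D_(delta_mx 0 i) f p'
   = (grad f p - grad f p') 0 i by rewrite !mxE.
rewrite (le_trans (entry_le_frobnorm _ _ _))// (le_trans (fL _ _))//.
rewrite -mulrA (le_trans (ler_norm _))// normrM ler_wpM2l//.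
by rewrite ger0_norm ?frobnorm_ge0// frobnorm_row_le.
Qed.

Lemma classC2_lipschitz L f i j : classC2 L f -> forall p p',
  `|'D_(delta_mx 0 j) ('D_(delta_mx 0 i) f) p
    - 'D_(delta_mx 0 j) ('D_(delta_mx 0 i) f) p'| <= `|L| * N%:R * `|p - p'|.
Proof.
move=> [_ _ fL] p p'.
have -> : 'D_(delta_mx 0 j) ('D_(delta_mx 0 i) f) p
    - 'D_(delta_mx 0 j) ('D_(delta_mx 0 i) f) p'
   = (hess f p - hess f p') i j by rewrite !mxE.
rewrite (le_trans (entry_le_opnorm _ _ _))// (le_trans (fL _ _))//.
rewrite -mulrA (le_trans (ler_norm _))// normrM ler_wpM2l//.
by rewrite ger0_norm ?frobnorm_ge0// frobnorm_row_le.
Qed.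

Lemma classC2_differentiable_partial L f i : classC2 L f ->
  forall p, differentiable ('D_(delta_mx 0 i) f) p.
Proof.
move=> [_ df _] p.
have -> : 'D_(delta_mx 0 i) f = (fun M : 'rV[R]_N => M 0 i : R) \o grad f.
  by apply/funext => q /=; rewrite mxE.
apply: differentiable_comp; [exact: df|exact: differentiable_coord].
Qed.

Lemma classC1_has_growth L f : classC1 L f ->
  has_growth f (`|f 0| + N%:R *
    \sum_i (`|'D_(delta_mx 0 i) f 0| + `|L| * N%:R)) 2.
Proof.
move=> fL; have S i : 0 <= `|'D_(delta_mx 0 i) f 0| + `|L| * N%:R.
  by rewrite addr_ge0 ?mulr_ge0.
apply: has_growth_of_partials; [exact: sumr_ge0|by case: fL|] => i.
apply: has_growth_le (lipschitz_has_growth _ (classC1_lipschitz i fL));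
  last first.
  by rewrite mulr_ge0.
by rewrite [leRHS](bigD1 i)//= lerDl sumr_ge0.
Qed.

Lemma classC2_has_growth_partial L f i : classC2 L f ->
  has_growth ('D_(delta_mx 0 i) f) (`|'D_(delta_mx 0 i) f 0| + N%:R *
    \sum_j (`|'D_(delta_mx 0 j) ('D_(delta_mx 0 i) f) 0| + `|L| * N%:R)) 2.
Proof.
move=> fL.
have S j : 0 <= `|'D_(delta_mx 0 j) ('D_(delta_mx 0 i) f) 0| + `|L| * N%:R.
  by rewrite addr_ge0 ?mulr_ge0.
apply: has_growth_of_partials; first exact: sumr_ge0.
  exact: classC2_differentiable_partial fL.
move=> j.
apply: has_growth_le (lipschitz_has_growth _ (classC2_lipschitz i j fL));
  last first.
  by rewrite mulr_ge0.
by rewrite [leRHS](bigD1 j)//= lerDl sumr_ge0.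
Qed.

Lemma classC2_has_growth L f : classC2 L f ->
  has_growth f (`|f 0| + N%:R *
    \sum_i (`|'D_(delta_mx 0 i) f 0| + N%:R *
      \sum_j (`|'D_(delta_mx 0 j) ('D_(delta_mx 0 i) f) 0| + `|L| * N%:R))) 3.
Proof.
move=> fL.
have S i := has_growth_ge0 (classC2_has_growth_partial i fL).
apply: has_growth_of_partials; [exact: sumr_ge0|by case: fL|] => i.
apply: has_growth_le (classC2_has_growth_partial i fL).
by rewrite [leRHS](bigD1 i)//= lerDl sumr_ge0.
Qed.

(** The integrability in zeta of the first partial derivatives of Q(., ., zeta)
    comes from this bound: by the mean value theorem along the i-th axis,
    f(e_i) - f(0) is a first partial derivative at an intermediate point, and a
    second application moves that point back to 0. *)
Lemma classC2_partial_le L f i : classC2 L f ->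
  `|'D_(delta_mx 0 i) f 0| <= `|f (delta_mx 0 i)| + `|f 0|
    + (`|'D_(delta_mx 0 i) ('D_(delta_mx 0 i) f) 0| + `|L| * N%:R).
Proof.
move=> fL; set e := delta_mx 0 i.
have [df _ _] := fL.
have [c /andP[c0 c1]] := mvt_line 0 e ler01 df.
rewrite scale1r !add0r mul1r => fE.
have [c' /andP[c'0 c'c]] :=
  mvt_line 0 e c0 (classC2_differentiable_partial i fL).
rewrite !add0r -/e => f'E.
have c'1 : c' <= 1 by exact: le_trans c1.
have e1 : `|c' *: e| <= 1.
  rewrite normrZ ger0_norm// mulr_ile1// norm_row_le// => j.
  by rewrite mxE ger0_norm// lern1 leq_b1.
have := classC2_lipschitz i i fL (c' *: e) 0; rewrite -/e subr0 => H.
set M := 'D_e ('D_e f) in f'E H *.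
have MB : `|M (c' *: e)| <= `|M 0| + `|L| * N%:R.
  have -> : M (c' *: e) = M 0 + (M (c' *: e) - M 0) by rewrite addrC subrK.
  rewrite (le_trans (ler_normD _ _))// lerD2l (le_trans H)//.
  by rewrite ler_piMr// mulr_ge0.
have -> : 'D_e f 0 = f e - f 0 - c * M (c' *: e).
  by rewrite fE -f'E opprB addrC subrK.
rewrite (le_trans (ler_normB _ _))// lerD ?ler_normB//.
by rewrite normrM (ger0_norm c0) (le_trans _ MB)// ler_piMl.
Qed.

End Growth.

Lemma has_growthB (R : realType) N (f g : 'rV[R]_N -> R) C C' k :
  has_growth f C k -> has_growth g C' k ->
  has_growth (fun p => f p - g p) (C + C') k.
Proof.
by move=> fC gC p; rewrite (le_trans (ler_normB _ _))// mulrDl lerD.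
Qed.

(** * Measurability *)

Section Measurability.
Context d (T : measurableType d) (R : realType).

(** The integral of a nonnegative function is a supremum over the simple
    functions below it, hence monotone even on non-measurable functions. This
    applies to the operator norm of a random matrix, a supremum over an
    uncountable family. *)
Lemma le_integral_nonneg (mu : {measure set T -> \bar R}) (f g : T -> \bar R) :
  (forall t, 0 <= f t)%E -> (forall t, f t <= g t)%E ->
  (\int[mu]_t f t <= \int[mu]_t g t)%E.
Proof.
move=> f0 fg; rewrite !ge0_integralTE//; last by move=> t; exact: le_trans (fg t).
apply: ereal_sup_le => _ [h /= hf <-]; exists h => //= t.
exact: le_trans (fg t).
Qed.

(** A function measurable in t and continuous in the point may be evaluated at a
    measurable random point. Rounding the coordinates of h t down to multiples of
    1/(n+1) gives points with countably many values, for which the claim is a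
    countable union over the values; continuity passes to the limit. *)
Lemma measurable_caratheodory N (G : T -> 'rV[R]_N -> R) (h : T -> 'rV[R]_N) :
  (forall p, measurable_fun setT (fun t => G t p)) ->
  (forall t, continuous (G t)) ->
  (forall i, measurable_fun setT (fun t => h t 0 i)) ->
  measurable_fun setT (fun t => G t (h t)).
Proof.
move=> mG cG mh.
pose c n t : 'rV[int]_N := \row_i Num.floor (n.+1%:R * h t 0 i).
pose a n (z : 'rV[int]_N) : 'rV[R]_N := \row_i ((z 0 i)%:~R / n.+1%:R).
apply: (@measurable_fun_cvg _ _ _ _ (fun n t => G t (a n (c n t)))).
  move=> n _ B mB; rewrite setTI.
  have -> : (fun t => G t (a n (c n t))) @^-1` B =
      \bigcup_z ([set t | c n t = z] `&` (fun t => G t (a n z)) @^-1` B).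
    apply/seteqP; split=> [t Bt|t [z _ [/= <- //]]].
    by exists (c n t).
  apply: countable_bigcupT_measurable; first exact: countableP.
  move=> z; apply: measurableI; last first.
    by rewrite -[X in measurable X]setTI; exact: mG.
  have -> : [set t | c n t = z] = \bigcap_(i in [set: 'I_N])
      ((fun t => n.+1%:R * h t 0 i) @^-1`
        `[(z 0 i)%:~R, (z 0 i + 1)%:~R[%classic).
    apply/seteqP; split=> [t <- i _|t /= zt].
      by rewrite /= in_itv/= mxE floor_itv.
    apply/rowP => i; rewrite mxE; apply/eqP.
    by rewrite floor_eq; have := zt i I; rewrite /= in_itv.
  apply: fin_bigcap_measurable; first exact: finite_finset.
  move=> i _; rewrite -[X in measurable X]setTI.
  by apply: measurable_funM.
move=> t _; apply: continuous_cvg; first exact: cG.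
apply/(@cvgrPdist_le _ _ _ _ _ (fun n => a n (c n t)) (h t)) => e e0.
near=> n.
apply: norm_row_le; first exact: ltW.
move=> i; rewrite !mxE.
have n0 : 0 < n.+1%:R :> R by [].
have := floor_itv (n.+1%:R * h t 0 i); set z := Num.floor _ => /andP[z1 z2].
have -> : h t 0 i - z%:~R / n.+1%:R = (n.+1%:R * h t 0 i - z%:~R) / n.+1%:R.
  by rewrite mulrBl mulrAC divff ?mul1r// gt_eqF.
rewrite normrM ger0_norm ?subr_ge0// ger0_norm ?invr_ge0//.
apply: (@le_trans _ _ n.+1%:R^-1).
  rewrite ler_piMl ?invr_ge0// lerBlDl ltW//.
  by rewrite -[X in _ + X]/(1%:~R) -intrD.
by near: n; near do rewrite ltW//;
  exact: (near_infty_natSinv_lt (PosNum e0)).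
Unshelve. all: by end_near. Qed.

(** A derivative is a limit of difference quotients with steps 1/(n+1). *)
Lemma measurable_derive N (G : T -> 'rV[R]_N -> R) p v :
  (forall q, measurable_fun setT (fun t => G t q)) ->
  (forall t, derivable (G t) p v) ->
  measurable_fun setT (fun t => 'D_v (G t) p).
Proof.
move=> mG dG.
apply: (@measurable_fun_cvg _ _ _ _
  (fun n t => n.+1%:R * (G t (n.+1%:R^-1 *: v + p) - G t p))).
  by move=> n; apply: measurable_funM => //; exact: measurable_funB.
move=> t _.
have H : h^-1 *: ((G t \o shift p) (h *: v) - G t p) @[h --> 0^'] --> 'D_v (G t) p.
  exact: dG.
have -> : (fun n => n.+1%:R * (G t (n.+1%:R^-1 *: v + p) - G t p))
   = (fun n => (n.+1%:R^-1)^-1 *: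
        ((G t \o shift p) (n.+1%:R^-1 *: v) - G t p)).
  by apply/funext => n; rewrite invrK.
move/cvgr_dnbhsP : H => /(_ (fun n => n.+1%:R^-1)); apply.
by split; [move=> n; rewrite invr_neq0|exact: cvg_harmonic].
Qed.

End Measurability.

(** * Averaging over a random shift *)

Section Smoothing.
Context d (Omega : measurableType d) (R : realType) (P : probability Omega R).
Context (N : nat) (S : Omega -> 'rV[R]_N).
Hypothesis mS : forall i, measurable_fun setT (fun w => S w 0 i).
Hypothesis momS : forall k,
  P.-integrable setT (fun w => ((1 + `|S w|) ^+ k)%:E).

Definition smooth (f : 'rV[R]_N -> R) (p : 'rV[R]_N) : R :=
  \int[P]_w f (p + S w).

Lemma measurable_shift d' (T : measurableType d') (p : 'rV[R]_N)
    (h : T -> Omega) i :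
  measurable_fun setT h -> measurable_fun setT (fun t => (p + S (h t)) 0 i).
Proof.
move=> mh; under eq_fun do rewrite mxE.
apply: measurable_funD => //.
exact: (measurableT_comp (mS i) mh).
Qed.

(** Submultiplicativity of 1 + |.| separates the base point from the
    perturbation. *)
Lemma has_growth_shift f C k p (s : 'rV[R]_N) : has_growth f C k ->
  `|f (p + s)| <= C * (1 + `|p|) ^+ k * (1 + `|s|) ^+ k.
Proof.
move=> fC; have C0 := has_growth_ge0 fC.
rewrite (le_trans (fC _))// -mulrA ler_wpM2l// -exprMn.
rewrite lerXn2r ?nnegrE ?mulr_ge0 ?addr_ge0//.
have := ler_normD p s; have : 0 <= `|p| * `|s| by rewrite mulr_ge0.
by rewrite mulrDl mul1r mulrDr mulr1; lra.
Qed.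

Lemma integrable_shift f C k p : continuous f -> has_growth f C k ->
  P.-integrable setT (EFin \o (fun w => f (p + S w))).
Proof.
move=> cf fC.
apply: (@le_integrable _ _ _ P setT _ _
  (fun w => ((C * (1 + `|p|) ^+ k)%:E * ((1 + `|S w|) ^+ k)%:E)%E)) => //.
- apply/measurable_EFinP.
  apply: (measurable_caratheodory (G := fun _ q => f q)) => //.
  by move=> i; exact: measurable_shift.
- move=> w _ /=; rewrite lee_fin [leRHS]ger0_norm ?has_growth_shift//.
  by rewrite !mulr_ge0 ?exprn_ge0 ?addr_ge0//; exact: has_growth_ge0 fC.
- exact: integrableZl.
Qed.

Lemma smoothB f g C k C' k' p :
  continuous f -> has_growth f C k -> continuous g -> has_growth g C' k' ->
  smooth f p - smooth g p = smooth (fun q => f q - g q) p.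
Proof.
by move=> cf fC cg gC; rewrite /smooth RintegralB//; [exact: integrable_shift fC|
  exact: integrable_shift gC].
Qed.

(** Differentiation under the expectation sign, on the line through p in the
    direction v. For |x| <= 1 the derivative at p + x v + S is dominated by a
    multiple of a power of 1 + |S|, which is integrable. *)
Lemma derive_smooth f C k C' k' p v : (forall q, differentiable f q) ->
  has_growth f C k -> has_growth ('D_v f) C' k' ->
  'D_v (smooth f) p = smooth ('D_v f) p.
Proof.
move=> df fC fC'.
have cf : continuous f by move=> q; exact: differentiable_continuous.
pose F (x : R) w := f (p + S w + x *: v).
have FE x w : partial1of2 F x w = 'D_v f (p + S w + x *: v).
  by rewrite partial1of2E derive_line.
have -> : 'D_v (smooth f) p = derive1 (fun x : R => \int[P]_w F x w) 0.
  rewrite derive1E -[in LHS](addr0 p) -(scale0r v) -derive_line.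
  suff -> : (fun s : R => smooth f (p + s *: v))
    = (fun x => \int[P]_w F x w) by [].
  apply/funext => x; apply: eq_Rintegral => w _.
  by rewrite /F addrAC.
rewrite (@differentiation_under_integral _ _ _ P F setT measurableT 0 (-1) 1 _ _ _
   (fun w => C' * (1 + (`|p| + `|v|)) ^+ k' * (1 + `|S w|) ^+ k')).
- apply: eq_Rintegral => w _.
  by rewrite FE scale0r addr0.
- by rewrite /= in_itv/= ltrN10 ltr01.
- move=> x _; have := integrable_shift (p + x *: v) cf fC.
  by congr integrable; apply/funext => w; rewrite /F/= addrAC.
- move=> x w _ _.
  by case: (is_derive_line (df (p + S w + x *: v))).
- move=> w; rewrite !mulr_ge0 ?exprn_ge0 ?addr_ge0//; exact: has_growth_ge0 fC'.
- under [X in integrable _ _ X]eq_fun do rewrite EFinM.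
  exact: integrableZl.
- move=> x w; rewrite /= in_itv/= => /andP[x1 x2] _.
  rewrite FE addrAC (le_trans (has_growth_shift _ _ fC'))//.
  rewrite ler_wpM2r ?exprn_ge0 ?addr_ge0// ler_wpM2l ?(has_growth_ge0 fC')//.
  rewrite lerXn2r ?nnegrE ?addr_ge0// lerD2l (le_trans (ler_normD _ _))//.
  rewrite lerD2l normrZ ler_piMl// ler_norml.
  by rewrite !ltW.
Qed.

(** The nonnegative function (X - a)^2, with a the mean of X, has integral
    E[X^2] - a^2. *)
Lemma sqr_Rintegral_le (X : Omega -> R) : P.-integrable setT (EFin \o X) ->
  (((\int[P]_w X w) ^+ 2)%:E <= \int[P]_w ((X w) ^+ 2)%:E)%E.
Proof.
move=> iX; set a := \int[P]_w X w.
have mX : measurable_fun setT X by apply/measurable_EFinP/(measurable_int P).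
have [->|fin] := eqVneq (\int[P]_w (X w ^+ 2)%:E)%E +oo%E; first exact: leey.
have iX2 : P.-integrable setT (EFin \o (fun w => X w ^+ 2)).
  apply/integrableP; split.
    by apply/measurable_EFinP; exact: measurable_funX.
  under eq_integral do rewrite /= ger0_norm ?sqr_ge0//.
  by rewrite ltey.
have iZ : P.-integrable setT (EFin \o (fun w => 2 * a * X w)).
  under [X in integrable _ _ X]eq_fun do rewrite /= EFinM.
  exact: integrableZl.
have iC : P.-integrable setT (EFin \o (fun _ : Omega => a ^+ 2)).
  exact: finite_measure_integrable_cst.
have -> : (\int[P]_w (X w ^+ 2)%:E = (\int[P]_w (X w ^+ 2))%:E)%E.
  by rewrite /Rintegral fineK//; exact: integrable_fin_num.
rewrite lee_fin.
have -> : a ^+ 2 = \int[P]_w (2 * a * X w - a ^+ 2).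
  rewrite RintegralB//= RintegralZl// Rintegral_cst//.
  rewrite -/a (_ : fine _ = 1); last exact: (congr1 fine (probability_setT P)).
  by ring.
apply: le_Rintegral => //.
  under [X in integrable _ _ X]eq_fun do rewrite /= EFinB.
  exact: integrableB.
by move=> w _; rewrite -subr_ge0 (_ : _ - _ = (X w - a) ^+ 2) ?sqr_ge0//; ring.
Qed.

(** Smoothing contracts the mean square norm: Jensen's inequality bounds the
    square of the average over the perturbation by the average of the squares,
    and Tonelli's theorem lets the average over the random field come first. *)
Lemma mean_square_smooth_le (I : finType) (X : I -> Omega -> 'rV[R]_N -> R)
    (s2 : R) (p : 'rV[R]_N) :
  (forall i q, measurable_fun setT (fun t => X i t q)) ->
  (forall i t, continuous (X i t)) ->
  (forall i t, exists C k, has_growth (X i t) C k) ->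
  (forall q, (\int[P]_t (\sum_i X i t q ^+ 2)%:E <= s2%:E)%E) ->
  (\int[P]_t (\sum_i smooth (X i t) p ^+ 2)%:E <= s2%:E)%E.
Proof.
move=> mX cX gX H.
pose f (tw : Omega * Omega) := (\sum_i X i tw.1 (p + S tw.2) ^+ 2)%:E.
have mXp i : measurable_fun setT
    (fun tw : Omega * Omega => X i tw.1 (p + S tw.2)).
  apply: (measurable_caratheodory (G := fun tw : Omega * Omega => X i tw.1)) => //.
    by move=> q; exact: (measurableT_comp (mX i q) measurable_fst).
  by move=> j; exact: (measurable_shift _ _ measurable_snd).
have mf : measurable_fun setT f.
  by apply/measurable_EFinP/measurable_sum => i; exact: measurable_funX.
have f0 tw : (0 <= f tw)%E by rewrite lee_fin sumr_ge0// => i _; rewrite sqr_ge0.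
apply: (@le_trans _ _ (\int[P]_t \int[P]_w f (t, w))%E).
  apply: le_integral_nonneg => t.
    by rewrite lee_fin sumr_ge0// => i _; rewrite sqr_ge0.
  rewrite /f/= -sumEFin.
  under [leRHS]eq_integral do rewrite -sumEFin.
  have mXt i : measurable_fun setT (fun w => X i t (p + S w)).
    exact: (measurableT_comp (mXp i) (measurable_pair1 t)).
  rewrite ge0_integral_sum//; last 2 first.
  - by move=> i; apply/measurable_EFinP; exact: measurable_funX.
  - by move=> i w _; rewrite lee_fin sqr_ge0.
  apply: lee_sum => i _; apply: sqr_Rintegral_le.
  by have [C [k XC]] := gX i t; exact: integrable_shift XC.
rewrite fubini_tonelli//.
apply: (@le_trans _ _ (\int[P]_w (cst s2%:E) w)%E).
  apply: le_integral_nonneg => w; first exact: integral_ge0.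
  by rewrite /f /=; exact: (H (p + S w)).
rewrite integral_cst//; set c := (X in (_ * X)%E).
by have -> : c = 1%E by [exact: (probability_setT P)]; rewrite mule1.
Qed.

End Smoothing.

(** * Moments of Gaussian vectors *)

Section Density.
Context d (T : measurableType d) (R : realType).
Local Open Scope ereal_scope.
Import HBNNSimple.

(** Simple functions suffice: the integral against [nu] is the supremum over
    simple h <= f, and for those the claim is linear in the indicators of the
    level sets. *)
Lemma le_integral_density (mu nu : {measure set T -> \bar R}) (g : T -> R)
    (f : T -> \bar R) :
  measurable_fun setT g -> (forall t, (0 <= g t)%R) ->
  (forall A, measurable A -> nu A = \int[mu]_(t in A) (g t)%:E) ->
  (forall t, 0 <= f t) ->
  \int[nu]_t f t <= \int[mu]_t (f t * (g t)%:E).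
Proof.
move=> mg g0 nuE f0; rewrite [leLHS]ge0_integralTE//.
apply: ge_ereal_sup => _ [h /= hf <-].
apply: (@le_trans _ _ (\int[mu]_t ((h t)%:E * (g t)%:E))); last first.
  apply: le_integral_nonneg => t; first by rewrite mule_ge0 ?lee_fin.
  by rewrite lee_wpmul2r ?lee_fin.
rewrite sintegralE.
have mgE : measurable_fun setT (EFin \o g) by exact/measurable_EFinP.
under eq_integral.
  move=> t _; rewrite [X in X%:E * _]fimfunE -fsumEFin//.
  rewrite ge0_mule_fsuml; last first.
    by move=> r; rewrite EFinM nnfun_muleindic_ge0.
  over.
rewrite ge0_integral_fsum//; last 2 first.
- move=> r; apply: emeasurable_funM => //.
  by apply/measurable_EFinP; apply: measurable_funM => //; exact: measurable_indic.
- by move=> r t _; rewrite mule_ge0 ?lee_fin// -lee_fin EFinM nnfun_muleindic_ge0.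
rewrite le_eqVlt; apply/orP; left; apply/eqP.
apply: eq_fsbigr => r /set_mem [t _ <-].
have r0 : (0 <= h t)%R by [].
rewrite nuE// [in LHS]integral_mkcond.
under [RHS]eq_integral do rewrite EFinM -muleA.
rewrite ge0_integralZl//.
- congr *%E; apply: eq_integral => s _; rewrite patchE indicE.
  by case: ifP => _; rewrite ?mul1e ?mul0e.
- apply: emeasurable_funM => //.
  by apply/measurable_EFinP; exact: measurable_indic.
- by move=> s _; rewrite mule_ge0 ?lee_fin.
Qed.

End Density.

Section GaussianMoments.
Context (R : realType).

(** With K = k + 1, exp(t^2/4) is the K-th power of exp(t^2/(4K)), which is at
    least 1 + t^2/(4K); and (4K + 2)(1 + t^2/(4K)) dominates 1 + |t|. *)
Lemma expR_ge_growth (t : R) k :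
  (1 + `|t|) ^+ k <= (4 * k.+1%:R + 2) ^+ k.+1 * expR (t ^+ 2 / 4).
Proof.
have k0 : 0 < k.+1%:R :> R by [].
apply: (@le_trans _ _ ((1 + `|t|) ^+ k.+1)).
  by rewrite ler_weXn2l// lerDl.
have -> : expR (t ^+ 2 / 4) = expR (t ^+ 2 / (4 * k.+1%:R)) ^+ k.+1.
  rewrite -expRM_natl; congr expR; field.
  by rewrite !gt_eqF.
rewrite -exprMn lerXn2r ?nnegrE ?addr_ge0 ?mulr_ge0 ?expR_ge0//.
apply: (@le_trans _ _ ((4 * k.+1%:R + 2) * (1 + t ^+ 2 / (4 * k.+1%:R))));
  last first.
  by rewrite ler_wpM2l ?expR_ge1Dx// addr_ge0 ?mulr_ge0.
have -> : (4 * k.+1%:R + 2) * (1 + t ^+ 2 / (4 * k.+1%:R))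
    = 4 * k.+1%:R + 2 + t ^+ 2 + 2 * (t ^+ 2 / (4 * k.+1%:R)).
  by field; rewrite gt_eqF.
have : 0 <= t ^+ 2 / (4 * k.+1%:R) by rewrite divr_ge0 ?sqr_ge0 ?mulr_ge0.
rewrite -(real_normK (num_real t)).
move: k0 (`|t| ^+ 2 / _) => + z z0; move: k.+1%:R => c c0.
by have := sqr_ge0 `|t|; have := sqr_ge0 (`|t| - 1); rewrite sqrrB1 -mulr_natr; lra.
Qed.

(** Half of the Gaussian exponent t^2/2 absorbs the polynomial; the other half
    is, up to a constant, the density of the centered normal law of variance 2. *)
Lemma gaussian_moment_lty k :
  (\int[normal_prob (0 : R) 1]_t ((1 + `|t|) ^+ k)%:E < +oo)%E.
Proof.
have s2 : Num.sqrt (2 : R) != 0 by rewrite gt_eqF// sqrtr_gt0.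
pose C : R :=
  (4 * k.+1%:R + 2) ^+ k.+1 * (normal_peak 1 / normal_peak (Num.sqrt 2)).
have C0 : 0 <= C.
  rewrite mulr_ge0 ?exprn_ge0 ?addr_ge0 ?mulr_ge0 ?invr_ge0//;
    exact: normal_peak_ge0.
apply: (@le_lt_trans _ _ (\int[lebesgue_measure]_t
    ((((1 + `|t|) ^+ k)%:E * (normal_pdf (0 : R) 1 t)%:E)))%E).
  apply: le_integral_density => //.
  - exact: measurable_normal_pdf.
  - exact: normal_pdf_ge0.
apply: (@le_lt_trans _ _ (\int[lebesgue_measure]_t
    (C%:E * (normal_pdf (0 : R) (Num.sqrt 2) t)%:E))%E).
  apply: le_integral_nonneg => t.
    by rewrite mule_ge0 ?lee_fin ?normal_pdf_ge0// exprn_ge0 ?addr_ge0.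
  rewrite -!EFinM lee_fin !normal_pdfE ?oner_neq0// /normal_fun subr0 /C.
  rewrite sqr_sqrtr// expr1n.
  have p2 : 0 < normal_peak (Num.sqrt (2 : R)) by exact: normal_peak_gt0.
  have p1 : 0 <= normal_peak (1 : R) by exact: normal_peak_ge0.
  have -> : (4 * k.+1%:R + 2) ^+ k.+1
        * (normal_peak 1 / normal_peak (Num.sqrt 2))
        * (normal_peak (Num.sqrt 2) * expR (- t ^+ 2 / (2 *+ 2)))
    = normal_peak 1
        * ((4 * k.+1%:R + 2) ^+ k.+1 * expR (- t ^+ 2 / (2 *+ 2))).
    by field; rewrite gt_eqF.
  rewrite mulrCA ler_wpM2l//.
  have -> : - t ^+ 2 / (1 *+ 2) = - (t ^+ 2 / 4) + - (t ^+ 2 / 4) by field.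
  have -> : - t ^+ 2 / (2 *+ 2) = - (t ^+ 2 / 4) by field.
  rewrite expRD mulrA ler_wpM2r ?expR_ge0//.
  rewrite expRN ler_pdivrMr ?expR_gt0//; exact: expR_ge_growth.
rewrite integralZl//; last exact: integrable_normal_pdf.
by rewrite integral_normal_pdf mule1 ltry.
Qed.

End GaussianMoments.

Section GaussianPerturbation.
Context d (Omega : measurableType d) (R : realType) (P : probability Omega R).

(** The i-th marginal of N(0, I_n) is N(0, 1): evaluate the law on the rectangle
    whose only proper side is the i-th. *)
Lemma integrable_gaussian_coord n
    (u : {RV P >-> n.-tuple (measurableTypeR R)}) i k :
  std_gaussian u ->
  P.-integrable setT (fun w => ((1 + `|tnth (u w) i|) ^+ k)%:E).
Proof.
move=> hu.
have mui : measurable_fun setT (fun w => tnth (u w) i).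
  exact: measurableT_comp (measurable_tnth i) _.
have mf : measurable_fun setT
    (fun t : measurableTypeR R => ((1 + `|t|) ^+ k)%:E).
  apply/measurable_EFinP; apply: measurable_funX; apply: measurable_funD => //.
apply/integrableP; split; first exact: (measurableT_comp mf mui).
under eq_integral do rewrite /= ger0_norm ?exprn_ge0 ?addr_ge0//.
rewrite (_ : integral _ _ _ = (\int[pushforward P (fun w => tnth (u w) i)]_t
   ((1 + `|t|) ^+ k)%:E)%E); last by rewrite ge0_integral_pushforward.
rewrite (eq_measure_integral (normal_prob 0 1)).
  exact: gaussian_moment_lty.
move=> A mA _.
pose B j := if j == i then A else setT.
have mB j : measurable (B j) by rewrite /B; case: ifP.
have := hu B mB; rewrite (bigD1 i)//= big1 => [|j ji]; last first.
  by rewrite /B (negbTE ji); exact: probability_setT.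
rewrite mule1 {2}/B eqxx => <-.
rewrite /pushforward /distribution /=; congr (P _).
apply/seteqP; split => w /=; rewrite /B.
  by move=> Aw j; case: eqP => // ->.
by move/(_ i); rewrite eqxx.
Qed.

(** The sup norm is attained at a coordinate (or is 0), so its power is at most
    1 plus the sum of the powers over all coordinates. *)
Lemma integrable_norm_pow N (S : Omega -> 'rV[R]_N) k :
  (forall i, measurable_fun setT (fun w => S w 0 i)) ->
  (forall i, P.-integrable setT (fun w => ((1 + `|S w 0 i|) ^+ k)%:E)) ->
  P.-integrable setT (fun w => ((1 + `|S w|) ^+ k)%:E).
Proof.
move=> mS iS.
apply: (@le_integrable _ _ _ P setT _ _
  (fun w => (1 + \sum_(i < N) ((1 + `|S w 0 i|) ^+ k)%:E)%E)) => //.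
- apply/measurable_EFinP.
  apply: measurable_funX; apply: measurable_funD => //.
  apply: (measurable_caratheodory (G := fun _ (q : 'rV[R]_N) => `|q|)) => //.
  by move=> t; exact: norm_continuous.
- move=> w _; rewrite sumEFin -EFinD !abse_EFin lee_fin.
  rewrite !ger0_norm ?exprn_ge0 ?addr_ge0 ?sumr_ge0//.
  have [->|S0] := eqVneq `|S w| 0.
    by rewrite addr0 expr1n lerDl sumr_ge0.
  have [[i j] /= Sij] := mx_norm_neq0 S0.
  rewrite (_ : `|S w| = `|S w 0 j|); last by rewrite -(ord1 i).
  by rewrite (bigD1 j)//= addrCA lerDl addr_ge0// sumr_ge0.
- apply: integrableD => //.
    exact: (finite_measure_integrable_cst P 1).
  exact: integrable_sum.
Qed.

End GaussianPerturbation.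

(** * Product laws and independence *)

Section ProductMeasures.
Local Open Scope ereal_scope.

(** Rectangles form a pi-system generating the product sigma-algebra. *)
Lemma eq_measure_rectangles d1 d2 (T1 : measurableType d1) (T2 : measurableType d2)
    (R : realType) (m1 m2 : {measure set (T1 * T2) -> \bar R}) :
  (forall A B, measurable A -> measurable B -> m1 (A `*` B) = m2 (A `*` B)) ->
  m1 setT < +oo -> forall C, measurable C -> m1 C = m2 C.
Proof.
move=> m12 fin C mC.
pose G : set (set (T1 * T2)) :=
  [set A `*` B | A in measurable & B in measurable].
have GT : G setT by exists setT => //; exists setT => //; rewrite setXTT.
apply: (measure_unique G (fun=> setT)) => //.
- exact: measurable_prod_measurableType.
- move=> _ _ [A mA [B mB <-]] [A' mA' [B' mB' <-]].
  by exists (A `&` A'); [exact: measurableI|exists (B `&` B');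
    [exact: measurableI|rewrite setXI]].
- by rewrite bigcup_const//; exists 0%N.
- by move=> _ [A mA [B mB <-]]; exact: m12.
Qed.

Context d (Omega : measurableType d) (R : realType) (P : probability Omega R).

(** For a fixed event B on X3, both sides are finite measures in A, and they
    agree on rectangles by mutual independence. *)
Lemma independent3_pair d1 d2 d3 (T1 : measurableType d1) (T2 : measurableType d2)
    (T3 : measurableType d3) (X1 : {RV P >-> T1}) (X2 : {RV P >-> T2})
    (X3 : {RV P >-> T3}) : independent3 X1 X2 X3 ->
  forall (A : set (T1 * T2)) (B : set T3), measurable A -> measurable B ->
  P ((fun w => (X1 w, X2 w)) @^-1` A `&` X3 @^-1` B) =
  P ((fun w => (X1 w, X2 w)) @^-1` A) * P (X3 @^-1` B).
Proof.
move=> ind A B mA mB.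
have m12 : measurable_fun setT (fun w => (X1 w, X2 w)).
  exact: measurable_fun_pair.
have mX3B : measurable (X3 @^-1` B) by exact: measurable_funPTI.
have PE : P (X3 @^-1` B) = (fine (P (X3 @^-1` B)))%:E.
  by rewrite fineK// fin_num_measure.
have c0 : (0 <= fine (P (X3 @^-1` B)))%R by rewrite fine_ge0.
rewrite [X in _ * X]PE muleC.
pose f w := (X1 w, X2 w).
apply: (@eq_measure_rectangles _ _ _ _ _
  (pushforward (mrestr P mX3B) f) (mscale (NngNum c0) (pushforward P f))) => //.
- move=> A1 A2 mA1 mA2.
  transitivity (P (X3 @^-1` B) * pushforward P f (A1 `*` A2)); last first.
    by rewrite [in LHS]PE.
  have E : P (f @^-1` (A1 `*` A2)) = P (X1 @^-1` A1) * P (X2 @^-1` A2).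
    have := ind _ _ _ mA1 mA2 (@measurableT _ T3).
    by rewrite preimage_setT setIT probability_setT mule1.
  by rewrite /pushforward E muleC; exact: ind.
- change (P (setT `&` X3 @^-1` B) < +oo).
  by rewrite setTI PE ltry.
Qed.

Section Independent.
Context d1 d2 (T1 : measurableType d1) (T2 : measurableType d2).
Context (U : Omega -> T1) (Z : Omega -> T2).
Hypotheses (mU : measurable_fun setT U) (mZ : measurable_fun setT Z).
Hypothesis ind : forall A B, measurable A -> measurable B ->
  P (U @^-1` A `&` Z @^-1` B) = P (U @^-1` A) * P (Z @^-1` B).

(** Under independence (U, Z) has the law of (U w, Z t) for (w, t) drawn from
    P \x P, so an expectation over one sample is an iterated one. *)
Lemma integral_independent (H : T1 * T2 -> R) : measurable_fun setT H ->
  \int[P]_w \int[P]_t `|(H (U w, Z t))%:E| < +oo ->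
  \int[P]_w (H (U w, Z w))%:E = \int[P]_w \int[P]_t (H (U w, Z t))%:E.
Proof.
move=> mH fin.
pose f w := (U w, Z w); pose g (wt : Omega * Omega) := (U wt.1, Z wt.2).
have mf : measurable_fun setT f by exact: measurable_fun_pair.
have mg : measurable_fun setT g.
  apply: measurable_fun_pair.
    exact: (measurableT_comp mU measurable_fst).
  exact: (measurableT_comp mZ measurable_snd).
have mHE : measurable_fun setT (EFin \o H) by exact/measurable_EFinP.
have law : forall C, measurable C ->
    pushforward P f C = pushforward (P \x P) g C.
  apply: (@eq_measure_rectangles _ _ _ _ _
    (pushforward P f) (pushforward (P \x P) g)) => //.
    move=> A B mA mB.
    change (P (U @^-1` A `&` Z @^-1` B)
      = (P \x P) ((U @^-1` A) `*` (Z @^-1` B))).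
    have mUA : measurable (U @^-1` A).
      by rewrite -[X in measurable X]setTI; exact: mU.
    have mZB : measurable (Z @^-1` B).
      by rewrite -[X in measurable X]setTI; exact: mZ.
    by rewrite ind// product_measure1E.
  change (P setT < +oo).
  by rewrite probability_setT ltry.
have ig : (P \x P).-integrable setT (EFin \o H \o g).
  by apply/integrable12ltyP => //; exact: measurableT_comp.
have if_ : P.-integrable setT (EFin \o H \o f).
  apply/integrableP; split; first exact: measurableT_comp.
  move/integrableP : ig => [_]; apply: le_lt_trans.
  rewrite le_eqVlt; apply/orP; left; apply/eqP.
  have mA : measurable_fun setT (fun y => `|(EFin \o H) y|).
    exact: measurableT_comp.
  transitivity (\int[pushforward P f]_y `|(EFin \o H) y|).
    by rewrite ge0_integral_pushforward.
  transitivity (\int[pushforward (P \x P) g]_y `|(EFin \o H) y|).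
    by apply: eq_measure_integral => C mC _; exact: law.
  by rewrite ge0_integral_pushforward.
transitivity (\int[pushforward P f]_y (EFin \o H) y).
  by rewrite integral_pushforward.
transitivity (\int[pushforward (P \x P) g]_y (EFin \o H) y).
  by apply: eq_measure_integral => C mC _; exact: law.
rewrite integral_pushforward//.
by rewrite preimage_setT -integral12_prod_meas1.
Qed.

End Independent.
End ProductMeasures.

(** * Integrable real functions *)

Section RealIntegrable.
Context d (Omega : measurableType d) (R : realType) (P : probability Omega R).
Implicit Types f g : Omega -> R.

Local Notation real_integrable f := (P.-integrable setT (EFin \o f)).

Lemma real_integrableD f g : real_integrable f -> real_integrable g ->
  real_integrable (fun w => f w + g w).
Proof.
move=> fi gi; have := integrableD measurableT fi gi.
by congr integrable; apply/funext.
Qed.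

Lemma real_integrableZ (c : R) f : real_integrable f ->
  real_integrable (fun w => c * f w).
Proof.
move=> fi; have := integrableZl measurableT c fi.
by congr integrable; apply/funext.
Qed.

Lemma real_integrable_cst (c : R) : real_integrable (fun=> c).
Proof. exact: finite_measure_integrable_cst. Qed.

Lemma real_integrable_norm f : real_integrable f ->
  real_integrable (fun w => `|f w|).
Proof. by move=> /integrable_abse; congr integrable; apply/funext. Qed.

Lemma real_integrable_sum (I : finType) (F : I -> Omega -> R) :
  (forall i, real_integrable (F i)) ->
  real_integrable (fun w => \sum_i F i w).
Proof.
move=> Fi.
have : P.-integrable setT (fun w => (\sum_i (F i w)%:E)%E).
  by apply: integrable_sum => // i _; exact: Fi.
by congr integrable; apply/funext => w /=; rewrite sumEFin.
Qed.

(** A finite expectation forces integrability, as an extended integral whose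
    positive or negative part diverges is infinite. *)
Lemma real_integrable_of_expectation f (c : R) : measurable_fun setT f ->
  ('E_P[f] = c%:E)%E -> real_integrable f.
Proof.
move=> mf; rewrite unlock => fc.
apply/integrableP; split; first exact/measurable_EFinP.
by apply/abse_integralP => //; [exact/measurable_EFinP|rewrite fc ltry].
Qed.

Lemma le_real_integrable f g : measurable_fun setT f ->
  (forall w, `|f w| <= g w) -> real_integrable g -> real_integrable f.
Proof.
move=> mf fg gi; apply: le_integrable gi => //; first exact/measurable_EFinP.
by move=> w _ /=; rewrite lee_fin (le_trans (fg w))// ler_norm.
Qed.

End RealIntegrable.

(** * Smoothed gradients and Hessians *)

Section Assembly.
Context (R : realType) (d : measure_display) (Omega : measurableType d).
Context (P : probability Omega R) (n m k : nat).
Context (u : {RV P >-> n.-tuple (measurableTypeR R)}).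
Context (v : {RV P >-> m.-tuple (measurableTypeR R)}).
Context (zeta : {RV P >-> k.-tuple (measurableTypeR R)}).
Hypotheses (hu : std_gaussian u) (hv : std_gaussian v).
Hypothesis huvz : independent3 u v zeta.
Context (Q : 'rV[R]_n -> 'rV[R]_m -> k.-tuple (measurableTypeR R) -> R).
Context (q : 'rV[R]_n -> 'rV[R]_m -> R).
Hypothesis hQ : mean_of zeta Q q.
Context (eta mu : R).

Local Notation N := (n + m)%N.
Local Notation Qz z := (joint (fun x y => Q x y z)).

Definition shift_uv (a : n.-tuple (measurableTypeR R))
    (b : m.-tuple (measurableTypeR R)) : 'rV[R]_(n + m) :=
  row_mx (eta *: vec a) (mu *: vec b).

Let S w := shift_uv (u w) (v w).

Lemma measurable_shift_uv d' (T : measurableType d')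
    (a : T -> n.-tuple (measurableTypeR R))
    (b : T -> m.-tuple (measurableTypeR R)) i :
  measurable_fun setT a -> measurable_fun setT b ->
  measurable_fun setT (fun t => shift_uv (a t) (b t) 0 i).
Proof.
move=> ma mb; rewrite /shift_uv; case: (split_ordP i) => j ->.
  under eq_fun do rewrite row_mxEl !mxE.
  apply: measurable_funM => //.
  exact: (measurableT_comp (measurable_tnth j) ma).
under eq_fun do rewrite row_mxEr !mxE.
apply: measurable_funM => //.
exact: (measurableT_comp (measurable_tnth j) mb).
Qed.

Let mS i : measurable_fun setT (fun w => S w 0 i).
Proof. exact: measurable_shift_uv. Qed.

(* Each coordinate of S is eta or mu times a standard Gaussian variable. *)
Let momS r : P.-integrable setT (fun w => ((1 + `|S w|) ^+ r)%:E).
Proof.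
apply: integrable_norm_pow => // i.
have scaled (c t : R) : (1 + `|c * t|) ^+ r <= (1 + `|c|) ^+ r * (1 + `|t|) ^+ r.
  rewrite -exprMn lerXn2r ?nnegrE ?mulr_ge0 ?addr_ge0// normrM.
  have : 0 <= `|c| by []. have : 0 <= `|t| by [].
  by move=> t0 c0; rewrite mulrDl mul1r mulrDr mulr1; lra.
have mSr : measurable_fun setT (fun w => (1 + `|S w 0 i|) ^+ r).
  apply: measurable_funX; apply: measurable_funD => //.
  exact: (measurableT_comp (@normr_measurable R setT) (mS i)).
have nn w : `|(1 + `|S w 0 i|) ^+ r| = (1 + `|S w 0 i|) ^+ r.
  by rewrite ger0_norm// exprn_ge0// addr_ge0.
rewrite /S /shift_uv in mSr nn *; case: (split_ordP i) mSr nn => j -> mSr nn.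
  apply: (le_real_integrable (g := fun w =>
    (1 + `|eta|) ^+ r * (1 + `|tnth (u w) j|) ^+ r)) => //.
    by move=> w; rewrite nn row_mxEl !mxE.
  exact/real_integrableZ/integrable_gaussian_coord.
apply: (le_real_integrable (g := fun w =>
    (1 + `|mu|) ^+ r * (1 + `|tnth (v w) j|) ^+ r)) => //.
  by move=> w; rewrite nn row_mxEr !mxE.
exact/real_integrableZ/integrable_gaussian_coord.
Qed.

Lemma joint_shift (f : 'rV[R]_n -> 'rV[R]_m -> R) (p : 'rV[R]_N) a b :
  joint f (p + shift_uv a b)
  = f (lsubmx p + eta *: vec a) (rsubmx p + mu *: vec b).
Proof. by rewrite /joint /shift_uv !linearD/= row_mxKl row_mxKr. Qed.

Lemma joint_smoothQ z : joint (smoothQ u v Q eta mu z) = smooth P S (Qz z).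
Proof.
apply/funext => p; rewrite [LHS]/joint /smoothQ /smooth unlock /Rintegral.
by congr fine; apply: eq_integral => w _; rewrite /S joint_shift.
Qed.

Lemma measurable_Q p : measurable_fun setT (fun w => Qz (zeta w) p).
Proof. exact: (measurableT_comp (hQ.1 _ _)). Qed.

Lemma integrable_Q p : P.-integrable setT (EFin \o (fun w => Qz (zeta w) p)).
Proof.
apply: real_integrable_of_expectation (hQ.2 (lsubmx p) (rsubmx p)).
exact: measurable_Q.
Qed.

(** Given u and v, averaging over zeta replaces Q by q, by independence and the
    mean hypothesis. The majorant C(z) (1 + |p|)^r makes the double integral
    absolutely convergent. *)
Lemma joint_smoothq (C : k.-tuple (measurableTypeR R) -> R) r :
  (forall z, continuous (Qz z)) -> (forall z, has_growth (Qz z) (C z) r) ->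
  P.-integrable setT (EFin \o (C \o zeta)) ->
  joint (smoothq u v zeta Q eta mu) = smooth P S (joint q).
Proof.
move=> cQ gQ iC; apply/funext => p.
rewrite [LHS]/joint /smoothq /smooth unlock /Rintegral; congr fine.
pose U w := (u w, v w).
pose H (abz : (n.-tuple (measurableTypeR R) * m.-tuple (measurableTypeR R))
     * k.-tuple (measurableTypeR R)) :=
  Qz abz.2 (p + shift_uv abz.1.1 abz.1.2).
have mH : measurable_fun setT H.
  apply: (measurable_caratheodory (G := fun abz :
    (n.-tuple (measurableTypeR R) * m.-tuple (measurableTypeR R))
    * k.-tuple (measurableTypeR R) => Qz abz.2)) => //.
    move=> r'; exact: (measurableT_comp (hQ.1 _ _) measurable_snd).
  move=> i; under eq_fun do rewrite mxE.
  apply: measurable_funD => //; apply: measurable_shift_uv.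
    exact: (measurableT_comp measurable_fst measurable_fst).
  exact: (measurableT_comp measurable_snd measurable_fst).
have mU : measurable_fun setT U by exact: measurable_fun_pair.
transitivity (\int[P]_w (H (U w, zeta w))%:E)%E.
  by apply: eq_integral => w _; rewrite /H joint_shift.
rewrite (integral_independent mU _ (independent3_pair huvz) mH)//.
  apply: eq_integral => w _; have := hQ.2 (lsubmx (p + S w)) (rsubmx (p + S w)).
  by rewrite unlock.
pose c := (\int[P]_t (C (zeta t))%:E)%E.
have C0 z : 0 <= C z by exact: has_growth_ge0 (gQ z).
have c0 : (0 <= c)%E by apply: integral_ge0 => t _; rewrite lee_fin.
have cfin : c \is a fin_num by exact: integrable_fin_num.
apply: (@le_lt_trans _ _
    (\int[P]_w ((fine c * (1 + `|p|) ^+ r) * (1 + `|S w|) ^+ r)%:E)%E).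
  apply: le_integral_nonneg => w; first exact: integral_ge0.
  apply: (@le_trans _ _ (\int[P]_t
      (((1 + `|p|) ^+ r * (1 + `|S w|) ^+ r)%:E * (C (zeta t))%:E))%E).
    apply: le_integral_nonneg => t //.
    rewrite -EFinM abse_EFin lee_fin mulrC mulrA.
    exact: has_growth_shift.
  rewrite integralZl// -/c -{1}(fineK cfin) -EFinM lee_fin.
  by rewrite mulrC mulrA.
exact: (integrable_lty measurableT (real_integrableZ _ (momS r))).
Qed.

(** The contraction estimate for the differences between a random field G(zeta)
    and a deterministic one g; the finite index runs over the entries of the
    gradient or of the Hessian. *)
Lemma mean_square_joint_le (I : finType)
    (G : I -> k.-tuple (measurableTypeR R) -> 'rV[R]_N -> R)
    (g : I -> 'rV[R]_N -> R) (s2 : R) r (p : 'rV[R]_N) :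
  (forall i p, measurable_fun setT (fun w => G i (zeta w) p)) ->
  (forall i z, continuous (G i z)) -> (forall i, continuous (g i)) ->
  (forall i z, exists C, has_growth (G i z) C r) ->
  (forall i, exists C, has_growth (g i) C r) ->
  (forall p, (\int[P]_w (\sum_i (G i (zeta w) p - g i p) ^+ 2)%:E <= s2%:E)%E) ->
  (\int[P]_w (\sum_i
     (smooth P S (G i (zeta w)) p - smooth P S (g i) p) ^+ 2)%:E <= s2%:E)%E.
Proof.
move=> mG cG cg gG gg H.
have := @mean_square_smooth_le _ _ _ P N S mS momS I
  (fun i w p => G i (zeta w) p - g i p) s2 p.
move=> K; apply: le_trans (K _ _ _ H).
- rewrite le_eqVlt; apply/orP; left; apply/eqP; apply: eq_integral => w _.
  congr EFin; apply: eq_bigr => i _.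
  have [C GC] := gG i (zeta w); have [C' gC] := gg i.
  by rewrite (smoothB mS momS _ (cG i (zeta w)) GC (cg i) gC).
- by move=> i p'; exact: measurable_funB.
- by move=> i w p'; apply: continuousB; [exact: cG|exact: cg].
- move=> i w; have [C GC] := gG i (zeta w); have [C' gC] := gg i.
  by exists (C + C'), r; exact: has_growthB.
Qed.

Lemma measurable_partial L i p : (forall z, classC1 L (Qz z)) ->
  measurable_fun setT (fun w => 'D_(delta_mx 0 i) (Qz (zeta w)) p).
Proof.
move=> QL; apply: measurable_derive => [r|w]; first exact: measurable_Q.
by apply: diff_derivable; case: (QL (zeta w)).
Qed.

Lemma mean_square_grad_le L s L' p :
  assumptionsC1 zeta Q q L s -> classC1 L' (joint q) ->
  (\int[P]_w ((frobnorm (grad (joint (smoothQ u v Q eta mu (zeta w))) p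
      - grad (joint (smoothq u v zeta Q eta mu)) p)) ^+ 2)%:E <= (s ^+ 2)%:E)%E.
Proof.
move=> [QL ub Hs] qL.
have dQ z r : differentiable (Qz z) r by case: (QL z).
have cQ z : continuous (Qz z) by move=> r; exact: differentiable_continuous.
have dq r : differentiable (joint q) r by case: qL.
have mD i r := measurable_partial i r QL.
have iD i r : P.-integrable setT
    (EFin \o (fun w => 'D_(delta_mx 0 i) (Qz (zeta w)) r)).
  apply: (real_integrable_of_expectation (c := grad (joint q) r 0 i)) => //.
  rewrite -ub; suff -> : (fun w => grad (Qz (zeta w)) r 0 i)
    = (fun w => 'D_(delta_mx 0 i) (Qz (zeta w)) r) by [].
  by apply/funext => w; rewrite mxE.
have L0 (l : R) : 0 <= `|l| * N%:R by rewrite mulr_ge0.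
have gQ i z := lipschitz_has_growth (L0 L) (classC1_lipschitz i (QL z)).
have gq i := lipschitz_has_growth (L0 L') (classC1_lipschitz i qL).
rewrite (joint_smoothq cQ (fun z => classC1_has_growth (QL z))); last first.
  apply: real_integrableD; first exact/real_integrable_norm/integrable_Q.
  apply: real_integrableZ; apply: real_integrable_sum => i.
  apply: real_integrableD; last exact: real_integrable_cst.
  exact/real_integrable_norm.
have := @mean_square_joint_le _ (fun i z => 'D_(delta_mx 0 i) (Qz z))
  (fun i => 'D_(delta_mx 0 i) (joint q)) (s ^+ 2) 1 p mD.
move=> K; apply: le_trans (K _ _ _ _ _).
- rewrite le_eqVlt; apply/orP; left; apply/eqP; apply: eq_integral => w _.
  rewrite sqr_frobnorm big_ord1 joint_smoothQ; congr EFin; apply: eq_bigr => i _.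
  rewrite !mxE (derive_smooth mS momS _ (dQ (zeta w))
    (classC1_has_growth (QL (zeta w))) (gQ i (zeta w))).
  by rewrite (derive_smooth mS momS _ dq (classC1_has_growth qL) (gq i)).
- by move=> i z; exact: lipschitz_continuous (classC1_lipschitz i (QL z)).
- by move=> i; exact: lipschitz_continuous (classC1_lipschitz i qL).
- by move=> i z; eexists; exact: gQ.
- by move=> i; eexists; exact: gq.
- move=> r; have := Hs r; rewrite unlock; apply: le_trans.
  rewrite le_eqVlt; apply/orP; left; apply/eqP; apply: eq_integral => w _.
  rewrite sqr_frobnorm big_ord1; congr EFin; apply: eq_bigr => i _.
  by rewrite !mxE.
Qed.

Lemma derive2_smooth L (f : 'rV[R]_N -> R) i j p : classC2 L f ->
  'D_(delta_mx 0 j) ('D_(delta_mx 0 i) (smooth P S f)) p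
  = smooth P S ('D_(delta_mx 0 j) ('D_(delta_mx 0 i) f)) p.
Proof.
move=> fL; have [df _ _] := fL.
have L0 : 0 <= `|L| * N%:R by rewrite mulr_ge0.
have gf := classC2_has_growth_partial i fL.
have -> : 'D_(delta_mx 0 i) (smooth P S f) = smooth P S ('D_(delta_mx 0 i) f).
  apply/funext => r.
  by rewrite (derive_smooth mS momS _ df (classC2_has_growth fL) gf).
by rewrite (derive_smooth mS momS _ (classC2_differentiable_partial i fL) gf
  (lipschitz_has_growth L0 (classC2_lipschitz i j fL))).
Qed.

Lemma mean_square_hess_le L s L' p :
  assumptionsC2 zeta Q q L s -> classC2 L' (joint q) ->
  (\int[P]_w ((frobnorm (hess (joint (smoothQ u v Q eta mu (zeta w))) p
      - hess (joint (smoothq u v zeta Q eta mu)) p)) ^+ 2)%:E <= (s ^+ 2)%:E)%E.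
Proof.
move=> [QL ub Hs] qL.
have dQ z r : differentiable (Qz z) r by case: (QL z).
have cQ z : continuous (Qz z) by move=> r; exact: differentiable_continuous.
have mD i r : measurable_fun setT (fun w => 'D_(delta_mx 0 i) (Qz (zeta w)) r).
  apply: measurable_derive => [r'|w]; first exact: measurable_Q.
  exact: diff_derivable.
have mD2 i j r : measurable_fun setT
    (fun w => 'D_(delta_mx 0 j) ('D_(delta_mx 0 i) (Qz (zeta w))) r).
  apply: measurable_derive => [r'|w]; first exact: mD.
  apply: diff_derivable.
  exact: (classC2_differentiable_partial i (QL (zeta w))).
have iD2 i j r : P.-integrable setT
    (EFin \o (fun w => 'D_(delta_mx 0 j) ('D_(delta_mx 0 i) (Qz (zeta w))) r)).
  apply: (real_integrable_of_expectation (c := hess (joint q) r i j)) => //.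
  rewrite -ub; suff -> : (fun w => hess (Qz (zeta w)) r i j)
    = (fun w => 'D_(delta_mx 0 j) ('D_(delta_mx 0 i) (Qz (zeta w))) r) by [].
  by apply/funext => w; rewrite mxE.
have iD i : P.-integrable setT
    (EFin \o (fun w => 'D_(delta_mx 0 i) (Qz (zeta w)) 0)).
  apply: le_real_integrable (fun w => classC2_partial_le i (QL (zeta w))) _ => //.
  apply: real_integrableD.
    by apply: real_integrableD; exact/real_integrable_norm/integrable_Q.
  apply: real_integrableD; last exact: real_integrable_cst.
  exact/real_integrable_norm.
have L0 (l : R) : 0 <= `|l| * N%:R by rewrite mulr_ge0.
rewrite (joint_smoothq cQ (fun z => classC2_has_growth (QL z))); last first.
  apply: real_integrableD; first exact/real_integrable_norm/integrable_Q.
  apply: real_integrableZ; apply: real_integrable_sum => i.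
  apply: real_integrableD; first exact/real_integrable_norm.
  apply: real_integrableZ; apply: real_integrable_sum => j.
  apply: real_integrableD; last exact: real_integrable_cst.
  exact/real_integrable_norm.
have := @mean_square_joint_le _
  (fun (ij : 'I_N * 'I_N) z => 'D_(delta_mx 0 ij.2) ('D_(delta_mx 0 ij.1) (Qz z)))
  (fun ij => 'D_(delta_mx 0 ij.2) ('D_(delta_mx 0 ij.1) (joint q))) (s ^+ 2) 1 p
  (fun ij => mD2 ij.1 ij.2).
move=> K; apply: le_trans (K _ _ _ _ _).
- rewrite le_eqVlt; apply/orP; left; apply/eqP; apply: eq_integral => w _.
  rewrite sqr_frobnorm pair_big/= joint_smoothQ; congr EFin.
  apply: eq_bigr => -[i j] _ /=.
  by rewrite !mxE (derive2_smooth _ _ _ (QL (zeta w))) (derive2_smooth _ _ _ qL).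
- by move=> ij z; exact: lipschitz_continuous (classC2_lipschitz ij.1 ij.2 (QL z)).
- by move=> ij; exact: lipschitz_continuous (classC2_lipschitz ij.1 ij.2 qL).
- move=> ij z; eexists.
  exact: (lipschitz_has_growth (L0 L) (classC2_lipschitz ij.1 ij.2 (QL z))).
- move=> ij; eexists.
  exact: (lipschitz_has_growth (L0 L') (classC2_lipschitz ij.1 ij.2 qL)).
- move=> r; have := Hs r; rewrite unlock; apply: le_trans.
  rewrite le_eqVlt; apply/orP; left; apply/eqP; apply: eq_integral => w _.
  rewrite sqr_frobnorm pair_big/=; congr EFin; apply: eq_bigr => -[i j] _ /=.
  by rewrite !mxE.
Qed.

End Assembly.

(** * The bounds *)

Theorem proposition2p3 (R : realType) (d : measure_display)
  (Omega : measurableType d) (P : probability Omega R) (n m k : nat)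
  (hn : (1 <= n)%N) (hm : (1 <= m)%N)
  (u : {RV P >-> n.-tuple (measurableTypeR R)})
  (v : {RV P >-> m.-tuple (measurableTypeR R)})
  (zeta : {RV P >-> k.-tuple (measurableTypeR R)})
  (hu : std_gaussian u) (hv : std_gaussian v)
  (huvz : independent3 u v zeta)
  (Q : 'rV[R]_n -> 'rV[R]_m -> k.-tuple (measurableTypeR R) -> R)
  (q : 'rV[R]_n -> 'rV[R]_m -> R) (hQ : mean_of zeta Q q)
  (eta mu : R) (heta : 0 < eta) (hmu : 0 < mu)
  (x : 'rV[R]_n) (y : 'rV[R]_m) :
  (forall L1Q sigma1Q L1q : R,
     assumptionsC1 zeta Q q L1Q sigma1Q -> classC1 L1q (joint q) ->
     ('E_P[fun w => ((frobnorm (grad_x (smoothQ u v Q eta mu (zeta w)) x y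
                               - grad_x (smoothq u v zeta Q eta mu) x y)) ^+ 2)%R]
      <= ((L1q + L1Q) ^+ 2 / 2
          * (eta * (n%:R + 3) `^ (3 / 2)
             + mu ^+ 2 / eta * m%:R * n%:R `^ (1 / 2)) ^+ 2
          + 2 * sigma1Q ^+ 2)%:E)%E
     /\
     ('E_P[fun w => ((frobnorm (grad_y (smoothQ u v Q eta mu (zeta w)) x y
                               - grad_y (smoothq u v zeta Q eta mu) x y)) ^+ 2)%R]
      <= ((L1q + L1Q) ^+ 2 / 2
          * (eta ^+ 2 / mu * n%:R * m%:R `^ (1 / 2)
             + mu * (m%:R + 3) `^ (3 / 2)) ^+ 2
          + 2 * sigma1Q ^+ 2)%:E)%E)
  /\
  (forall L2Q sigma2Q L2q : R,
     assumptionsC2 zeta Q q L2Q sigma2Q -> classC2 L2q (joint q) ->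
     ('E_P[fun w => ((opnorm (hess_xy (smoothQ u v Q eta mu (zeta w)) x y
                             - hess_xy (smoothq u v zeta Q eta mu) x y)) ^+ 2)%R]
      <= (8 * (L2q + L2Q) ^+ 2 / 9
          * (eta ^+ 2 / mu * (n%:R + 4) ^+ 2 * m%:R `^ (1 / 2)
             + mu ^+ 2 / eta * (m%:R + 4) ^+ 2 * n%:R `^ (1 / 2)) ^+ 2
          + 2 * sigma2Q ^+ 2)%:E)%E).
Proof.
(* sigma^2 is below any bound of the stated shape. *)
have slack (c a s : R) : 0 <= c ->
    ((s ^+ 2)%:E <= (c * a ^+ 2 + 2 * s ^+ 2)%:E)%E.
  move=> c0; rewrite lee_fin; have := sqr_ge0 s.
  by have := mulr_ge0 c0 (sqr_ge0 a); lra.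
split=> [L1Q s L1q AQ Cq|L2Q s L2q AQ Cq].
  have M := mean_square_grad_le hu hv huvz hQ eta mu (row_mx x y) AQ Cq.
  have c0 : 0 <= (L1q + L1Q) ^+ 2 / 2 by rewrite divr_ge0 ?sqr_ge0.
  split; rewrite unlock; apply: le_trans (slack _ _ _ c0); apply: le_trans M;
    apply: le_integral_nonneg => w; rewrite lee_fin ?sqr_ge0//.
    by rewrite /grad_x -linearB sqr_frobnorm_lsubmx_le.
  by rewrite /grad_y -linearB sqr_frobnorm_rsubmx_le.
have M := mean_square_hess_le hu hv huvz hQ eta mu (row_mx x y) AQ Cq.
have c0 : 0 <= 8 * (L2q + L2Q) ^+ 2 / 9.
  by have := sqr_ge0 (L2q + L2Q); lra.
rewrite unlock; apply: le_trans (slack _ _ _ c0); apply: le_trans M.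
apply: le_integral_nonneg => w; rewrite lee_fin ?sqr_ge0//.
set A := hess _ _; set B := hess _ _.
have -> : hess_xy (smoothQ u v Q eta mu (zeta w)) x y
    - hess_xy (smoothq u v zeta Q eta mu) x y = ursubmx (A - B).
  by apply/matrixP => i j; rewrite /hess_xy /A /B !mxE.
apply: (@le_trans _ _ (frobnorm (ursubmx (A - B)) ^+ 2)).
  by rewrite ler_sqr ?nnegrE ?opnorm_ge0 ?frobnorm_ge0 ?opnorm_le_frobnorm.
rewrite /ursubmx (le_trans (sqr_frobnorm_rsubmx_le _))//.
exact: sqr_frobnorm_usubmx_le.
Qed.
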